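(* Let $\mathcal{M}$ be a finite dimensional Riemannian manifold with retraction $R$, let $F=f+g:\mathcal{M}\to\mathbb{R}$ with $f$ differentiable and $g$ continuous (possibly nonsmooth), let $x_0\in\mathcal{M}$ and $\tilde L>L$. Suppose: (a) $F$ is bounded from below and $\Omega_{x_0}=\{x\in\mathcal{M}\mid F(x)\le F(x_0)\}$ is compact; (b) there exists an open set $\Omega\supseteq\Omega_{x_0}$ such that $f$ is $L$-retraction-smooth and retraction-convex with respect to $R$ in $\Omega$, and $g$ is retraction-convex with respect to $R$ in $\Omega$; (c) there exists a constant $\kappa_\Omega$ such that for all $x,y,z\in\Omega$, with $\eta_x=R_x^{-1}(y)$, $\xi_x=R_x^{-1}(z)$, $\zeta_y=R_y^{-1}(z)$, $$\left|\|\xi_x-\eta_x\|_x^2-\|\zeta_y\|_y^2\right|\le\kappa_\Omega\|\eta_x\|_x^2.$$ Let $\{x_k\}$ be a sequence generated by the Riemannian proximal gradient method (RPG) described in the context, started at $x_0$, and let $x_*$ be any accumulation point of $\{x_k\}$. Then for all $k\ge1$, $$F(x_k)-F(x_* )\le\frac1k\left(\frac{\tilde L}{2}\|R_{x_0}^{-1}(x_* )\|_{x_0}^2+\frac{\tilde L\,\kappa_\Omega}{2\beta}\,(F(x_0)-F(x_* ))\right),$$ where $\beta=(\tilde L-L)/2$.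
   Context: Retraction: a smooth ($C^\infty$) map $R:\mathrm{T}\mathcal{M}\to\mathcal{M}$, defined on the whole tangent bundle, with restriction $R_x=R|_{\mathrm{T}_x\mathcal{M}}$, such that $R_x(0_x)=x$ for all $x$ and $\frac{d}{dt}R_x(t\eta_x)|_{t=0}=\eta_x$ for all $\eta_x\in\mathrm{T}_x\mathcal{M}$. $\langle\cdot,\cdot\rangle_x$ and $\|\cdot\|_x$ denote the Riemannian metric and induced norm on $\mathrm{T}_x\mathcal{M}$; $\mathrm{grad} f$ is the Riemannian gradient. In assumption (c) the inverses $R_x^{-1}(y)$ are understood to be well-defined for points of $\Omega$. RPG: given $x_0$ and $\tilde L>L$, for $k=0,1,\dots$: let $\ell_{x_k}(\eta)=\langle\mathrm{grad} f(x_k),\eta\rangle_{x_k}+\frac{\tilde L}{2}\|\eta\|_{x_k}^2+g(R_{x_k}(\eta))$ for $\eta\in\mathrm{T}_{x_k}\mathcal{M}$; find $\eta_{x_k}^*\in\mathrm{T}_{x_k}\mathcal{M}$ that is a stationary point of $\ell_{x_k}$ on $\mathrm{T}_{x_k}\mathcal{M}$ (i.e. $0$ is in its Clarke subdifferential there) and satisfies $\ell_{x_k}(0)\ge\ell_{x_k}(\eta_{x_k}^* )$; set $x_{k+1}=R_{x_k}(\eta_{x_k}^* )$. $L$-retraction-smooth: $h:\mathcal{M}\to\mathbb{R}$ is $L$-retraction-smooth with respect to $R$ in $\mathcal{N}\subseteq\mathcal{M}$ if for any $x\in\mathcal{N}$ and any $\mathcal{S}_x\subseteq\mathrm{T}_x\mathcal{M}$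 with $R_x(\mathcal{S}_x)\subseteq\mathcal{N}$, one has $h(R_x(\eta))\le h(x)+\langle\mathrm{grad} h(x),\eta\rangle_x+\frac L2\|\eta\|_x^2$ for all $\eta\in\mathcal{S}_x$. Retraction-convex: $h:\mathcal{M}\to\mathbb{R}$ is retraction-convex with respect to $R$ in $\mathcal{N}\subseteq\mathcal{M}$ if for any $x\in\mathcal{N}$ and any $\mathcal{S}_x\subseteq\mathrm{T}_x\mathcal{M}$ with $R_x(\mathcal{S}_x)\subseteq\mathcal{N}$, the function $q_x=h\circ R_x$ satisfies $q_x(\eta)\ge q_x(\xi)+\langle\zeta,\eta-\xi\rangle_x$ for all $\eta,\xi\in\mathcal{S}_x$, where $\zeta=\mathrm{grad}\,q_x(\xi)$ if $h$ is differentiable and otherwise $\zeta$ is any (Clarke) subgradient of $q_x$ at $\xi$. Clarke subdifferential of a function $q$ on $\mathrm{T}_x\mathcal{M}$ (introduced in the paper for Lipschitz continuous functions): $q^\circ(\eta;v)=\limsup_{\xi\to\eta,\,t\downarrow0}\frac{q(\xi+tv)-q(\xi)}{t}$ and $\partial q(\eta)=\{\zeta\in\mathrm{T}_x\mathcal{M}\mid\langle\zeta,v\rangle_x\le q^\circ(\eta;v)\ \forall v\in\mathrm{T}_x\mathcal{M}\}$.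
   Formalization: The formal theorem additionally assumes that all iterates x_k lie in Ω; without this the claim fails, since a step to a stationary point with ℓ(0) ≥ ℓ(η* ) may leave Ω and increase F. *)

(* Defs.v *)
From HB Require Import structures.
From mathcomp Require Import all_boot all_order all_algebra.
From mathcomp Require Import all_classical all_reals all_analysis.

Set Implicit Arguments.
Unset Strict Implicit.
Unset Printing Implicit Defensive.

Import Order.TTheory GRing.Theory Num.Theory.
Import numFieldNormedType.Exports.

Local Open Scope classical_set_scope.
Local Open Scope ring_scope.

(* Intended for U open: 'D_v f and differentiability at a point of U then only
   depend on f on U, so f may take arbitrary values outside U. *)
Fixpoint Ck (R : realType) (V W : normedModType R) (k : nat) (U : set V)
    (f : V -> W) : Prop :=
  match k with
  | 0%N => forall x, U x -> {for x, continuous f}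
  | k'.+1 => (forall x, U x -> differentiable f x) /\
             (forall v : V, Ck k' U ('D_v f))
  end.

Definition smooth_on (R : realType) (V W : normedModType R) (U : set V)
  (f : V -> W) : Prop := forall k, Ck k U f.

(* A homeomorphism between an open subset of M and an open subset of R^n; the
   values of [cmap] outside [cdom] and of [cinv] outside [ccod] are junk. *)
Record chart (R : realType) (n : nat) (M : topologicalType) := Chart {
  cmap :> M -> 'rV[R]_n ;
  cinv : 'rV[R]_n -> M ;
  cdom : set M ;
  ccod : set 'rV[R]_n ;
  cdom_open : open cdom ;
  ccod_open : open ccod ;
  cmap_cod : forall x, cdom x -> ccod (cmap x) ;
  cinv_dom : forall u, ccod u -> cdom (cinv u) ;
  cmapK : forall x, cdom x -> cinv (cmap x) = x ;
  cinvK : forall u, ccod u -> cmap (cinv u) = u ;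
  cmap_continuous : forall x, cdom x -> {for x, continuous cmap} ;
  cinv_continuous : forall u, ccod u -> {for u, continuous cinv}
}.

(* The atlas need not be maximal.  Each point x has a distinguished chart
   [chart_at x] of the atlas around it, used to represent tangent vectors. *)
Record smoothManifold (R : realType) (n : nat) := SmoothManifold {
  mcarrier :> topologicalType ;
  m_hausdorff : hausdorff_space mcarrier ;
  m_second_countable : @second_countable mcarrier ;
  atlas : set (chart R n mcarrier) ;
  transition_smooth : forall phi psi, atlas phi -> atlas psi ->
    smooth_on (ccod phi `&` cinv phi @^-1` cdom psi) (psi \o cinv phi) ;
  chart_at : mcarrier -> chart R n mcarrier ;
  chart_at_atlas : forall x, atlas (chart_at x) ;
  chart_at_dom : forall x, cdom (chart_at x) x
}.
Arguments atlas {R n} s.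
Arguments chart_at {R n s} x.

Section Tangent.
Variables (R : realType) (n : nat) (M : smoothManifold R n).

(* T_x M is identified with R^n through [chart_at x]: an element of
   [tangent x] is the coordinate vector of a tangent vector in that chart. *)
Definition tangent (x : M) : normedModType R := 'rV[R]_n.

(* Coordinates of v in another chart phi around x, and the inverse change. *)
Definition to_chart (phi : chart R n M) (x : M) (v : tangent x) : 'rV[R]_n :=
  'd (phi \o cinv (chart_at x)) (chart_at x x) v.

Definition of_chart (phi : chart R n M) (x : M) (w : 'rV[R]_n) : tangent x :=
  'd (chart_at x \o cinv phi) (phi x) w.

Definition mdifferentiable (h : M -> R) : Prop :=
  forall x, differentiable (h \o cinv (chart_at x)) (chart_at x x).

(* Smoothness of a map TM -> M, read in the charts of TM induced by charts phi
   of M; openness of the coordinate domains amounts to continuity. *)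
Definition tangent_bundle_smooth (Ret : forall x : M, tangent x -> M) : Prop :=
  forall phi psi : chart R n M, atlas M phi -> atlas M psi ->
  let rep := fun p : 'rV[R]_n * 'rV[R]_n =>
    Ret (cinv phi p.1) (of_chart phi (cinv phi p.1) p.2) in
  let D := [set p | ccod phi p.1 /\ cdom psi (rep p)] in
  open D /\ smooth_on D (psi \o rep).

Record retraction (Ret : forall x : M, tangent x -> M) : Prop := Retraction {
  retr_smooth : tangent_bundle_smooth Ret ;
  retr0 : forall x, Ret x 0 = x ;
  retr_velocity : forall (x : M) (eta : tangent x),
    is_derive (0 : R) (1 : R)
      (fun t : R => chart_at x (Ret x (t *: eta)) : 'rV[R]_n) eta
}.

(* R_x^{-1}(y): only meaningful when y has exactly one preimage. *)
Definition retr_inv (Ret : forall x : M, tangent x -> M) (x y : M) : tangent x :=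
  xget 0 [set eta | Ret x eta = y].

End Tangent.

Record riemannianManifold (R : realType) (n : nat) := RiemannianManifold {
  rbase :> smoothManifold R n ;
  metric : forall x : rbase, tangent x -> tangent x -> R ;
  metric_linear : forall (x : rbase) (a : R) (u v w : tangent x),
    metric (a *: u + v) w = a * metric u w + metric v w ;
  metric_sym : forall (x : rbase) (u v : tangent x), metric u v = metric v u ;
  metric_pos : forall (x : rbase) (v : tangent x), v != 0 -> 0 < metric v v ;
  metric_smooth : forall phi : chart R n rbase, atlas rbase phi ->
    forall w1 w2 : 'rV[R]_n,
    smooth_on (ccod phi) (fun u =>
      metric (of_chart phi (cinv phi u) w1) (of_chart phi (cinv phi u) w2) : R)
}.
Arguments metric {R n r} x _ _.

Section Riemannian.
Variables (R : realType) (n : nat) (M : riemannianManifold R n).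

Definition rnorm (x : M) (v : tangent x) : R := Num.sqrt (metric x v v).

(* Gradient at xi of q : T_x M -> R for the inner product <.,.>_x; only
   meaningful when q is differentiable at xi. *)
Definition tgrad (x : M) (q : tangent x -> R) (xi : tangent x) : tangent x :=
  xget 0 [set zeta | forall v, metric x zeta v = 'd q xi v].

Definition grad (h : M -> R) (x : M) : tangent x :=
  @tgrad x (h \o cinv (chart_at x)) (chart_at x x).

(* q^o(eta; v), an extended real since q need not be Lipschitz. *)
Definition clarke_dderiv (x : M) (q : tangent x -> R) (eta v : tangent x)
    : \bar R :=
  limf_esup (fun p : tangent x * R => ((q (p.1 + p.2 *: v) - q p.1) / p.2)%:E)
    (filter_prod (nbhs eta) (0 : R)^'+).

Definition clarke_subdiff (x : M) (q : tangent x -> R) (eta : tangent x)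
    : set (tangent x) :=
  [set zeta | forall v, ((metric x zeta v)%:E <= clarke_dderiv q eta v)%E].

Variable Ret : forall x : M, tangent x -> M.

Definition retraction_smooth (L : R) (h : M -> R) (N : set M) : Prop :=
  forall x, N x -> forall S : set (tangent x), @Ret x @` S `<=` N ->
  forall eta, S eta ->
    h (Ret eta) <= h x + metric x (grad h x) eta + L / 2 * rnorm eta ^+ 2.

Definition retraction_convex (h : M -> R) (N : set M) : Prop :=
  forall x, N x -> forall S : set (tangent x), @Ret x @` S `<=` N ->
  let q := h \o @Ret x in
  forall eta xi, S eta -> S xi -> forall zeta : tangent x,
    (mdifferentiable h /\ zeta = tgrad q xi) \/
    (~ mdifferentiable h /\ clarke_subdiff q xi zeta) ->
    q xi + metric x zeta (eta - xi) <= q eta.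

Definition rpg_model (f g : M -> R) (Lt : R) (x : M) (eta : tangent x) : R :=
  metric x (grad f x) eta + Lt / 2 * rnorm eta ^+ 2 + g (Ret eta).

Definition rpg_step (f g : M -> R) (Lt : R) (x y : M) : Prop :=
  exists eta : tangent x,
    [/\ clarke_subdiff (@rpg_model f g Lt x) eta 0,
        @rpg_model f g Lt x eta <= @rpg_model f g Lt x 0
      & y = Ret eta].

Definition rpg_sequence (f g : M -> R) (Lt : R) (x0 : M) (x : nat -> M) : Prop :=
  x 0%N = x0 /\ forall k, rpg_step f g Lt (x k) (x k.+1).

End Riemannian.

(* Main.v *)
Require Import Defs.
From HB Require Import structures.
From mathcomp Require Import all_boot all_order all_algebra.
From mathcomp Require Import all_classical all_reals all_analysis.
From mathcomp Require Import lra ring.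

Set Implicit Arguments.
Unset Strict Implicit.
Unset Printing Implicit Defensive.

Import Order.TTheory GRing.Theory Num.Theory.
Import numFieldNormedType.Exports.

Local Open Scope classical_set_scope.
Local Open Scope ring_scope.

(** Convexity of f and g along R_(x_k), together with stationarity of the
    proximal model, gives for the step eta_k and any xi with R_(x_k)(xi) = xs
      F(x_(k+1)) - F(xs) <= Lt/2 (|xi|^2 - |xi - eta_k|^2).
    Assumption (c) replaces |xi - eta_k| by |R_(x_(k+1))^-1(xs)| at the cost
    of kappa |eta_k|^2, and the decrease F(x_k) - F(x_(k+1)) >= beta |eta_k|^2
    pays for that error; the bounds telescope.

    Two points need care.  Retraction convexity of a differentiable g speaks
    only of gradients, whereas stationarity yields a Clarke subgradient; the
    two agree because g o R_x is convex near the step, so its difference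
    quotients are monotone in the step length.  The signs of Lt and kappa are
    not given: convexity and L-smoothness of f force L |eta|^2 >= 0, and (c)
    forces kappa |eta|^2 >= 0, for every tangent eta in question, so with a
    wrong sign all of these vanish. *)

(** * Differentials: locality and reduction to lines *)

(** The little-o expansion that characterizes the differential sees only the germ at [a]. This lets
    chart round trips, which are the identity only locally, be cancelled. *)
Lemma near_eq_is_diff (R : numFieldType) (V W : normedModType R)
    (f g : V -> W) (a : V) :
  {near a, f =1 g} -> differentiable f a -> is_diff a g ('d f a).
Proof.
move=> fg df; have [dfc dfo] := (diff_locallyP _ _).1 df.
have dgo : g \o shift a = cst (g a) + 'd f a +o_ 0 id.
  apply/eqaddoP => e e0; move/eqaddoP: dfo => /(_ e e0) dfo.
  have sfg : \forall h \near 0, f (h + a) = g (h + a).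
    by move: fg; rewrite (near_shift 0); apply: filterS => h /=; rewrite subr0.
  apply: filterS2 dfo sfg => h; rewrite /= !fctE /= => + E.
  by rewrite -E -(nbhs_singleton fg).
have dg : 'd g a = 'd f a :> (V -> W) by apply: diff_unique.
by apply: DiffDef => //; apply/diff_locallyP; rewrite dg.
Qed.

(** Puts the differential in the form in which [retr_velocity] is stated. *)
Lemma diff_derive_line (R : numFieldType) (V W : normedModType R)
    (f : V -> W) (a v : V) :
  differentiable f a -> 'd f a v = 'D_1 (fun t : R => f (a + t *: v)) 0.
Proof.
move=> df; rewrite -deriveE// /derive;
apply: (congr1 (fun k : R -> W => lim (k @ 0^'))); apply/funext => h.
by rewrite /= addr0 scale0r addr0 [_ *: 1]mulr1 [a + _]addrC.
Qed.

(** * Regularity of the retraction on a fibre, and of functions composed with it *)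

Section RetractionDiff.
Variables (R : realType) (n : nat) (M : smoothManifold R n).

Lemma near_cinvK (phi : chart R n M) (x : M) :
  cdom phi x -> {near x, cancel phi (cinv phi)}.
Proof.
move=> px; have := open_nbhs_nbhs (conj (@cdom_open _ _ _ phi) px).
by apply: (@filterS _ (nbhs x)) => y; exact: cmapK.
Qed.

Lemma near_cmapK (phi : chart R n M) (x : M) :
  cdom phi x -> {near phi x, cancel (cinv phi) phi}.
Proof.
move=> px; have := open_nbhs_nbhs (conj (@ccod_open _ _ _ phi) (cmap_cod px)).
by apply: (@filterS _ (nbhs (phi x))) => y; exact: cinvK.
Qed.

Lemma of_chart_at (x : M) (w : 'rV[R]_n) : of_chart (chart_at x) x w = w.
Proof.
rewrite /of_chart.
have px := chart_at_dom x.
have dc : {near chart_at x x, id =1 chart_at x \o cinv (chart_at x)}.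
  by apply: filterS (near_cmapK px) => u /= ->.
have [_ ->] := near_eq_is_diff dc ex_diff.
by rewrite (diff_val (f := id)).
Qed.

Variable Ret : forall x : M, tangent x -> M.
Hypothesis hRet : retraction Ret.

Lemma retr_rep (x : M) (eta : 'rV[R]_n) :
  let phi := chart_at x in
  Ret (of_chart phi (cinv phi (phi x)) eta : tangent (cinv phi (phi x)))
  = Ret (eta : tangent x).
Proof.
move=> /=; rewrite (cmapK (chart_at_dom x)).
by congr Ret; exact: of_chart_at.
Qed.

(** Smoothness is given on the tangent bundle. Restricting the local representative to the slice
    with base point [phi x] fixed recovers [@Ret x]: openness of [D] gives the first claim, and the
    order 1 case of [smooth_on] the second. *)
Lemma retr_chart_diff (x : M) (eta : tangent x) (psi : chart R n M) :
  atlas M psi -> cdom psi (Ret eta) ->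
  (\forall xi \near eta, cdom psi (Ret (xi : tangent x))) /\
  differentiable (psi \o @Ret x) eta.
Proof.
move=> apsi dpsi; set phi := chart_at x.
have [oD sD] := retr_smooth hRet (chart_at_atlas x) apsi.
have px : ccod phi (phi x) by apply/cmap_cod/chart_at_dom.
pose i (xi : 'rV[R]_n) : 'rV[R]_n * 'rV[R]_n := (phi x, xi).
have di xi : differentiable i xi by apply: differentiable_pair.
pose D := [set p : 'rV[R]_n * 'rV[R]_n | ccod phi p.1 /\ cdom psi
  (Ret (of_chart phi (cinv phi p.1) p.2 : tangent (cinv phi p.1)))].
have Di : D (i eta).
  by split => //=; rewrite retr_rep.
split.
  have h : \forall xi \near eta, D (i xi).
    exact: (differentiable_continuous (di eta) (open_nbhs_nbhs (conj oD Di))).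
  by apply: filterS h => xi [_] /=; rewrite retr_rep.
have [dD _] := sD 1%N; have := differentiable_comp (di eta) (dD _ Di).
rewrite (_ : _ \o i = psi \o @Ret x)//.
by apply/funext => xi /=; rewrite retr_rep.
Qed.

Lemma retr_continuous (x : M) : continuous (@Ret x).
Proof.
move=> eta; set psi := chart_at (Ret eta).
have dpsi : cdom psi (Ret eta) := chart_at_dom _.
have [ndom dif] := retr_chart_diff (chart_at_atlas (Ret eta)) dpsi.
have ci : cinv psi u @[u --> psi (Ret eta)] --> cinv psi (psi (Ret eta)).
  exact: cinv_continuous (cmap_cod dpsi).
have c : (cinv psi \o (psi \o @Ret x)) xi @[xi --> eta] --> Ret eta.
  rewrite -[X in _ --> X](cmapK dpsi).
  exact: (cvg_comp _ _ (differentiable_continuous dif) ci).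
apply: cvg_trans c; apply: (@near_eq_cvg _ _ (nbhs eta)).
by apply: filterS ndom => xi /= h; rewrite cmapK.
Qed.

Lemma mdifferentiable_retr (h : M -> R) (x : M) (eta : tangent x) :
  mdifferentiable h -> differentiable (h \o @Ret x) eta.
Proof.
move=> hh; set psi := chart_at (Ret eta).
have [ndom dif] :=
  retr_chart_diff (chart_at_atlas (Ret eta)) (chart_at_dom (Ret eta)).
have dh : differentiable ((h \o cinv psi) \o (psi \o @Ret x)) eta.
  by apply: differentiable_comp => //; exact: hh.
have e : {near eta, (h \o cinv psi) \o (psi \o @Ret x) =1 h \o @Ret x}.
  by apply: filterS ndom => xi /= d; rewrite cmapK.
by have [] := near_eq_is_diff e dh.
Qed.

(** The velocity condition says that [psi \o @Ret x] has the identity as differential at 0, so the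
    chain rule applies. This links [grad h x], defined in a chart, to the gradient of [h \o @Ret x]
    at 0. *)
Lemma diff_retr0 (h : M -> R) (x : M) : mdifferentiable h ->
  'd (h \o @Ret x) (0 : tangent x) = 'd (h \o cinv (chart_at x)) (chart_at x x)
  :> (tangent x -> R).
Proof.
move=> hh; set psi := chart_at x.
have R0 : Ret (0 : tangent x) = x by exact: retr0 hRet x.
have d0 : cdom psi (Ret (0 : tangent x)) by rewrite R0; exact: chart_at_dom.
have [ndom dif] := retr_chart_diff (chart_at_atlas x) d0.
have dh : differentiable (h \o cinv psi) ((psi \o @Ret x) 0).
  by rewrite /= R0; exact: hh.
have e : {near (0 : tangent x),
    (h \o cinv psi) \o (psi \o @Ret x) =1 h \o @Ret x}.
  by apply: filterS ndom => xi /= d; rewrite cmapK.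
have dc : differentiable ((h \o cinv psi) \o (psi \o @Ret x)) (0 : tangent x).
  exact: differentiable_comp dif dh.
have E : 'd (h \o @Ret x) (0 : tangent x) =
    'd ((h \o cinv psi) \o (psi \o @Ret x)) (0 : tangent x)
    :> (tangent x -> R).
  by have [] := near_eq_is_diff e dc.
apply: (eq_trans E); apply: (eq_trans (diff_comp dif dh)).
have dv (v : tangent x) : 'd (psi \o @Ret x) (0 : tangent x) v = v.
  apply: (eq_trans (diff_derive_line v dif)).
  have [_ dv] := retr_velocity hRet v; apply: (eq_trans _ dv).
  congr (@derive R R^o _ _ 0 1); apply/funext => t /=; by rewrite add0r.
apply/funext => v.
exact: (congr2 (fun (p w : 'rV[R]_n) => 'd (h \o cinv psi) p w)
  (congr1 psi R0) (dv v)).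
Qed.

Lemma mdifferentiable_continuous (h : M -> R) :
  mdifferentiable h -> continuous h.
Proof.
move=> hh x; set psi := chart_at x.
have dx : cdom psi x := chart_at_dom x.
have c : ((h \o cinv psi) \o psi) y @[y --> x] --> h x.
  rewrite -[X in _ --> h X](cmapK dx).
  exact: (cvg_comp _ _ (cmap_continuous dx) (differentiable_continuous (hh x))).
apply: cvg_trans c; apply: (@near_eq_cvg _ _ (nbhs x)).
by apply: filterS (near_cinvK dx) => y /= ->.
Qed.

End RetractionDiff.

(** * Upper limits along a filter *)

Lemma le_limf_esup_near (R : realType) (T : choiceType) (X : filteredType T)
    (F : set_system X) {FF : Filter F} (v : X -> R) (c d : R) :
  (c%:E <= limf_esup (fun p => (v p)%:E) F)%E -> (F [set p | v p <= d]) ->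
  c <= d.
Proof.
move=> cv vd; rewrite -lee_fin; apply: (le_trans cv); apply: ge_ereal_inf.
exists (ereal_sup ((fun p => (v p)%:E) @` [set p | v p <= d])).
  by exists [set p | v p <= d].
by apply: ge_ereal_sup => _ [p vp <-]; rewrite lee_fin.
Qed.

(** A convergent summand splits off: on a small enough set of the filter, [u] exceeds [l] by at most
    [e]. No bound on [v] is assumed, so the supremum [S] may be infinite. *)
Lemma le_limf_esupD (R : realType) (T : choiceType) (X : filteredType T)
    (F : set_system X) {FF : Filter F} (u v : X -> R) (l c : R) : u @ F --> l ->
  (c%:E <= limf_esup (fun p => (u p + v p)%:E) F)%E ->
  ((c - l)%:E <= limf_esup (fun p => (v p)%:E) F)%E.
Proof.
move=> ul cuv; apply: le_ereal_inf_tmp => _ [A FA <-].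
apply/lee_addgt0Pr => e e0.
set S := ereal_sup _.
have ll : l < l + e by rewrite ltrDl.
have ule : F [set p | u p <= l + e] by exact: (cvgr_le _ ul _ ll).
have : (c%:E <= (l + e)%:E + S)%E.
  apply: (le_trans cuv); apply: ge_ereal_inf.
  exists (ereal_sup ((fun p => (u p + v p)%:E) @`
      (A `&` [set p | u p <= l + e]))).
    by exists (A `&` [set p | u p <= l + e]) => //; exact: filterI.
  apply: ge_ereal_sup => _ [p [Ap up] <-]; rewrite EFinD; apply: leeD.
    by rewrite lee_fin.
  by apply: ereal_sup_ubound; exists p.
case: S => [r||] //=; rewrite -?EFinD ?lee_fin ?leey //.
lra.
Qed.

(** * The inner product on one tangent space *)

Section Metric.
Variables (R : realType) (n : nat) (M : riemannianManifold R n) (x : M).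
Implicit Types u v w : tangent x.

Lemma metricDl u v w : metric x (u + v) w = metric x u w + metric x v w.
Proof. by rewrite -[u]scale1r metric_linear mul1r !scale1r. Qed.

Lemma metric0l w : metric x 0 w = 0.
Proof. by apply: (addrI (metric x 0 w)); rewrite -metricDl !addr0. Qed.

Lemma metricZl a u w : metric x (a *: u) w = a * metric x u w.
Proof. by rewrite -[a *: u]addr0 metric_linear metric0l addr0. Qed.

Lemma metricNl u w : metric x (- u) w = - metric x u w.
Proof. by rewrite -scaleN1r metricZl mulN1r. Qed.

Lemma metricBl u v w : metric x (u - v) w = metric x u w - metric x v w.
Proof. by rewrite metricDl metricNl. Qed.

Lemma metricDr u v w : metric x w (u + v) = metric x w u + metric x w v.
Proof. by rewrite Defs.metric_sym metricDl !(Defs.metric_sym _ w). Qed.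

Lemma metricZr a u w : metric x w (a *: u) = a * metric x w u.
Proof. by rewrite Defs.metric_sym metricZl (Defs.metric_sym _ w). Qed.

Lemma metricNr u w : metric x w (- u) = - metric x w u.
Proof. by rewrite Defs.metric_sym metricNl (Defs.metric_sym _ w). Qed.

Lemma metricBr u v w : metric x w (u - v) = metric x w u - metric x w v.
Proof. by rewrite metricDr metricNr. Qed.

Lemma metric_ge0 u : 0 <= metric x u u.
Proof.
by have [->|u0] := eqVneq u 0; rewrite ?metric0l// ltW// metric_pos.
Qed.

Lemma rnormE u : rnorm u ^+ 2 = metric x u u.
Proof. by rewrite /rnorm sqr_sqrtr// metric_ge0. Qed.

Lemma metric_inj u v : (forall w, metric x u w = metric x v w) -> u = v.
Proof.
move=> uv; apply/eqP; rewrite -subr_eq0; apply/negPn/negP => /metric_pos.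
by rewrite metricBl uv subrr ltxx.
Qed.

Lemma metric_suml (I : Type) (r : seq I) (P : pred I) (E : I -> tangent x) w :
  metric x (\sum_(i <- r | P i) E i) w = \sum_(i <- r | P i) metric x (E i) w.
Proof.
apply: (big_morph (fun u => metric x u w)); last exact: metric0l.
by move=> u v; exact: metricDl.
Qed.

(** Continuity comes from finite dimension: by linearity the function is a combination of the
    coordinates of [u]. *)
Lemma metric_continuousl w : continuous (fun u => metric x u w).
Proof.
have -> : (fun u => metric x u w) =
    (fun u => \sum_(j < n)
       (u : 'rV[R]_n) 0 j * metric x (delta_mx 0 j : 'rV[R]_n) w).
  apply/funext => u; rewrite [in LHS](row_sum_delta (u : 'rV[R]_n)).
  by rewrite metric_suml; apply: eq_bigr => j _; exact: metricZl.
move=> u.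
have := @cvg_big R _ +%R 0 xpredT (@add_continuous R) (tangent x) (nbhs u)
  (index_enum 'I_n)
  (fun j v => (v : 'rV[R]_n) 0 j * metric x (delta_mx 0 j : 'rV[R]_n) w).
apply.
move=> j _; apply: cvgMr_tmp; exact: (@coord_continuous R 1 n 0 j u).
Qed.

End Metric.

(** * Clarke subgradients: removing a quadratic, and the convex differentiable case *)

Section Clarke.
Variables (R : realType) (n : nat) (M : riemannianManifold R n) (x : M).
Implicit Types (q : tangent x -> R) (eta zeta v G : tangent x).

(** The difference quotients of the quadratic part converge jointly in base point and step length,
    so they leave the upper limit as an additive term. Applied to the proximal model, this turns
    stationarity into an explicit subgradient of [g \o @Ret x]. *)
Lemma clarke_subdiff_quad q eta G (c : R) :
  clarke_subdiff
    (fun xi => metric x G xi + c / 2 * rnorm xi ^+ 2 + q xi) eta 0 ->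
  clarke_subdiff q eta (- (G + c *: eta)).
Proof.
move=> h v; have := h v; rewrite metric0l metricNl metricDl metricZl.
rewrite /clarke_dderiv.
pose s xi := metric x G xi + c / 2 * rnorm xi ^+ 2.
pose u (p : tangent x * R) := (s (p.1 + p.2 *: v) - s p.1) / p.2.
pose w (p : tangent x * R) := (q (p.1 + p.2 *: v) - q p.1) / p.2.
rewrite (_ : (fun p : tangent x * R => _) = fun p => (u p + w p)%:E);
  last first.
  apply/funext => p; congr EFin.
  by rewrite /u /w -mulrDl /s; congr (_ / _); ring.
rewrite -[- _]sub0r; apply: le_limf_esupD.
(* The quotient of [s] at [(xi, t)] is exactly an affine expression in [xi] and [t]; the limit is
   written with its vanishing [t] term to match. *)
have -> : metric x G v + c * metric x eta v =
   metric x G v + c * metric x eta v + 0 * (c / 2 * metric x v v).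
  by rewrite mul0r addr0.
have cf : p.1 @[p --> filter_prod (nbhs eta) (0 : R)^'+] --> eta.
  exact: cvg_fst.
have cs : p.2 @[p --> filter_prod (nbhs eta) (0 : R)^'+] --> (0 : R).
  have s0 : p.2 @[p --> filter_prod (nbhs eta) (0 : R)^'+] --> 0^'+.
    exact: cvg_snd.
  by apply: (cvg_trans s0); exact: cvg_within.
have cl : metric x G v + c * metric x p.1 v + p.2 * (c / 2 * metric x v v)
    @[p --> filter_prod (nbhs eta) (0 : R)^'+] -->
    metric x G v + c * metric x eta v + 0 * (c / 2 * metric x v v).
  apply: cvgD; last exact: cvgMr_tmp.
  apply: cvgD; first exact: cvg_cst.
  apply: cvgMl_tmp;
  exact: (cvg_comp fst (fun u => metric x u v) cf
    (@metric_continuousl _ _ _ x v eta)).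
apply: cvg_trans cl; apply: near_eq_cvg.
have : \forall t \near (0 : R)^'+, 0 < t by exact: nbhs_right_gt.
move=> /(filter_prod2 (F := nbhs eta)); apply: filterS => -[xi t] /= t0.
rewrite /u /s /= !rnormE !(metricDl, metricDr, metricZl, metricZr).
rewrite (Defs.metric_sym v xi); field; exact: lt0r_neq0.
Qed.

(** Near [eta], quotients with short steps are at most the quotient with a fixed step [s], which is
    continuous in the base point. Hence the Clarke derivative along [v] is at most the quotient at
    [eta] with step [s]; letting [s] tend to 0 bounds it by the differential. Using [- v] as well
    gives equality. *)
Lemma clarke_subdiff_convex_diff q (g : tangent x -> tangent x)
    (U : set (tangent x)) eta zeta :
  nbhs eta U -> continuous q -> differentiable q eta ->
  (forall xi xi', U xi -> U xi' ->
     q xi + metric x (g xi) (xi' - xi) <= q xi') ->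
  clarke_subdiff q eta zeta -> forall v, metric x zeta v = 'd q eta v.
Proof.
move=> nU cq dq qcvx hz.
suff le v : metric x zeta v <= 'd q eta v.
  move=> v; apply/eqP; rewrite eq_le le /=.
  by have := le (- v); rewrite metricNr linearN lerN2.
(* The gradient inequality at [xi + t *: v] is tested at both endpoints; the weights [t] and [s - t]
   cancel the gradient term. *)
have slope (xi : tangent x) (t s : R) : 0 < t -> t < s ->
    U xi -> U (xi + t *: v) -> U (xi + s *: v) ->
    (q (xi + t *: v) - q xi) / t <= (q (xi + s *: v) - q xi) / s.
  move=> t0 ts U0 Ut Us.
  have := qcvx _ _ Ut U0; have := qcvx _ _ Ut Us.
  have -> : xi + s *: v - (xi + t *: v) = (s - t) *: v.
    by rewrite opprD addrACA subrr add0r scalerBl.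
  have -> : xi - (xi + t *: v) = (- t) *: v.
    by rewrite opprD addrA subrr add0r scaleNr.
  rewrite !metricZr; set gv := metric x _ v => h1 h2.
  have s0 : 0 < s by lra.
  rewrite ler_pdivrMr// mulrAC ler_pdivlMr//.
  have k1 := ler_wpM2l (ltW t0) h1.
  have st0 : 0 <= s - t by lra.
  have k2 := ler_wpM2l st0 h2.
  lra.
have /nbhs_normP[r /= r0 rU] := nU.
(* The radius is halved between the distance from [xi] to [eta] and the displacement along [v], so
   all three points used by [slope] stay in [U]. *)
have step (s : R) : 0 < s -> s * `|v| < r / 2 ->
    metric x zeta v <= s^-1 * (q (s *: v + eta) - q eta).
  move=> s0 sr; apply/ler_addgt0Pr => e e0.
  pose hs (xi : tangent x) := s^-1 * (q (s *: v + xi) - q xi).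
  have ch : hs xi @[xi --> eta] --> hs eta.
    have ca : s *: v + xi @[xi --> eta] --> s *: v + eta.
      by apply: (@cvgD _ _ _ (nbhs eta)); [exact: cvg_cst|exact: cvg_id].
    have cb : q (s *: v + xi) @[xi --> eta] --> q (s *: v + eta).
      exact: (cvg_comp (fun xi => s *: v + xi) q ca (cq _)).
    have cc : q (s *: v + xi) - q xi @[xi --> eta] --> q (s *: v + eta) - q eta.
      exact: (cvgB cb (cq eta)).
    exact: (cvgMl_tmp (a := s^-1) cc).
  apply: (le_limf_esup_near (hz v)).
  have n1 : \forall xi \near eta, hs xi <= hs eta + e /\ `|eta - xi| < r / 2.
    have hl : hs eta < hs eta + e by rewrite ltrDl.
    have a1 : \forall xi \near eta, hs xi <= hs eta + e.
      exact: (cvgr_le _ ch _ hl).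
    have a2 : \forall xi \near eta, `|eta - xi| < r / 2.
      by apply/nbhs_normP; exists (r / 2) => //=; rewrite divr_gt0.
    by apply: (@filterS2 _ (nbhs eta)) a1 a2 => xi.
  have n2 : \forall t \near (0 : R)^'+, 0 < t /\ t < s.
    have b1 : \forall t \near (0 : R)^'+, 0 < t by exact: nbhs_right_gt.
    have b2 : \forall t \near (0 : R)^'+, t < s by exact: nbhs_right_lt.
    by apply: filterS2 b1 b2 => t.
  exists ([set xi | hs xi <= hs eta + e /\ `|eta - xi| < r / 2],
    [set t | 0 < t /\ t < s]) => //= -[xi t] /= [[hxi xir] [t0 ts]].
  apply: le_trans hxi; rewrite /hs mulrC [s *: v + xi]addrC.
  have inU (a : R) : 0 <= a -> a <= s -> U (xi + a *: v).
    move=> a0 as_; apply: rU => /=; rewrite opprD addrA.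
    apply: (le_lt_trans (ler_normB _ _)); rewrite normrZ ger0_norm//.
    have : a * `|v| <= s * `|v| by rewrite ler_wpM2r.
    lra.
  rewrite mulrC [X in _ <= X]mulrC; apply: slope => //.
  - by have := inU 0; rewrite scale0r addr0; apply => //; lra.
  - by apply: inU; lra.
  - by apply: inU; lra.
have dv : derivable q eta v by exact: diff_derivable.
rewrite -deriveE//.
have c0 : s^-1 *: (q (s *: v + eta) - q eta) @[s --> (0 : R)^'+] --> 'D_v q eta.
  by apply: cvg_dnbhs_at_right; exact: dv.
apply: (cvgr_to_ge c0).
have b1 : \forall t \near (0 : R)^'+, 0 < t by exact: nbhs_right_gt.
(* Adding 1 to the norm keeps the denominator positive when [v] is 0. *)
have b2 : \forall t \near (0 : R)^'+, t < r / 2 / (`|v| + 1).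
  by apply: nbhs_right_lt; rewrite !divr_gt0// ltr_wpDl.
apply: filterS2 b1 b2 => t t0 tr; apply: step => //.
have v1 : 0 < `|v| + 1 by rewrite ltr_wpDl.
move: tr; rewrite ltr_pdivlMr// mulrDr mulr1 => h; lra.
Qed.

End Clarke.

(** * Lower bounds from retraction convexity *)

Section RetractionConvex.
Variables (R : realType) (n : nat) (M : riemannianManifold R n).
Variable Ret : forall x : M, tangent x -> M.
Hypothesis hRet : retraction Ret.
Variable Omega : set M.

Lemma retraction_convex_grad (f : M -> R) (x : M) (eta : tangent x) :
  mdifferentiable f -> retraction_convex Ret f Omega ->
  Omega x -> Omega (Ret eta) -> f x + metric x (grad f x) eta <= f (Ret eta).
Proof.
move=> df cf Ox Oe.
have R0 : Ret (0 : tangent x) = x by exact: retr0 hRet x.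
have hS : @Ret x @` [set xi | xi = 0 \/ xi = eta] `<=` Omega.
  by move=> _ [xi [->|->] <-] //; rewrite R0.
(* Both gradients are the same [xget] choice once the differentials agree, so no existence of a
   representing vector is needed here. *)
have gE : grad f x = tgrad (f \o @Ret x) (0 : tangent x).
  exact: (congr1 (fun d : tangent x -> R =>
    xget 0 [set zeta | forall v, metric x zeta v = d v])
    (esym (diff_retr0 hRet x df))).
have := cf x Ox _ hS eta 0 (or_intror erefl) (or_introl erefl) (grad f x)
  (or_introl (conj df gE)).
by rewrite subr0 -[X in X + _]/(f (Ret (0 : tangent x))) (congr1 f R0).
Qed.

Lemma retraction_convex_subgrad (g : M -> R) (x : M) (eta xi zeta : tangent x) :
  open Omega -> continuous g -> retraction_convex Ret g Omega ->
  Omega x -> Omega (Ret eta) -> Omega (Ret xi) ->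
  clarke_subdiff (g \o @Ret x) eta zeta ->
  g (Ret eta) + metric x zeta (xi - eta) <= g (Ret xi).
Proof.
move=> oO cg gcvx Ox Oe Oxi hz.
have [dg|ndg] := pselect (mdifferentiable g); last first.
  have hS : @Ret x @` [set a | a = eta \/ a = xi] `<=` Omega.
    by move=> _ [a [->|->] <-].
  have := gcvx x Ox _ hS xi eta (or_intror erefl) (or_introl erefl) zeta.
  by apply; right.
(* Two points do not suffice in the differentiable case: monotone quotients need the gradient
   inequality on a neighbourhood of [eta], which the full preimage provides because [Omega] is
   open. *)
set U := @Ret x @^-1` Omega.
have hS : @Ret x @` U `<=` Omega by move=> _ [a Ua <-].
have ineq a b : U a -> U b ->
    g (Ret a) + metric x (tgrad (g \o @Ret x) a) (b - a) <= g (Ret b).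
  by move=> Ua Ub; apply: (gcvx x Ox U hS b a Ub Ua); left.
have nU : nbhs eta U.
  by apply: (retr_continuous hRet); exact: (open_nbhs_nbhs (conj oO Oe)).
have cq : continuous (g \o @Ret x).
  by move=> a; apply: continuous_comp; [exact: retr_continuous|exact: cg].
have dq : differentiable (g \o @Ret x) eta by exact: mdifferentiable_retr.
have zd := clarke_subdiff_convex_diff nU cq dq ineq hz.
(* [zeta] itself witnesses that the gradient exists; nondegeneracy of the metric gives
   uniqueness. *)
have -> : zeta = tgrad (g \o @Ret x) eta; last exact: ineq.
apply/esym/xget_unique => // y hy; apply: metric_inj => w.
by rewrite hy zd.
Qed.

End RetractionConvex.

Lemma cluster_closed (T : topologicalType) (F : set_system T) (A : set T)
    (p : T) :
  cluster F p -> F A -> closed A -> A p.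
Proof. by rewrite clusterE => /(_ A) h FA cA; apply: cA; exact: h. Qed.

(** * Estimates for a single proximal step *)

Section OneStep.
Variables (R : realType) (n : nat) (M : riemannianManifold R n).
Variable Ret : forall x : M, tangent x -> M.
Hypothesis hRet : retraction Ret.
Variables (f g : M -> R) (L Lt : R) (Omega : set M).
Hypotheses (hf : mdifferentiable f) (hg : continuous g) (hLt : L < Lt).
Hypothesis hOmega : open Omega.
Hypothesis hf_smooth : retraction_smooth Ret L f Omega.
Hypothesis hf_convex : retraction_convex Ret f Omega.
Hypothesis hg_convex : retraction_convex Ret g Omega.

Lemma retraction_smooth_le (x : M) (eta : tangent x) :
  Omega x -> Omega (Ret eta) ->
  f (Ret eta) <= f x + metric x (grad f x) eta + L / 2 * rnorm eta ^+ 2.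
Proof.
move=> Ox Oe; apply: (hf_smooth Ox (S := [set eta])) => //.
by move=> _ [_ -> <-].
Qed.

Lemma retraction_smooth_convex_ge0 (x : M) (eta : tangent x) :
  Omega x -> Omega (Ret eta) -> 0 <= L * rnorm eta ^+ 2.
Proof.
move=> Ox Oe.
have h1 := retraction_smooth_le Ox Oe.
have h2 := retraction_convex_grad hRet hf hf_convex Ox Oe.
set d := rnorm eta ^+ 2 in h1 *; set m := metric x _ _ in h1 h2.
lra.
Qed.

Lemma rpg_one_step (x y : M) : Omega x -> Omega y -> rpg_step Ret f g Lt x y ->
  exists eta : tangent x, [/\ Ret eta = y,
    (Lt - L) / 2 * rnorm eta ^+ 2 <= (f x + g x) - (f y + g y) &
    forall xi : tangent x, Omega (Ret xi) ->
      (f y + g y) - (f (Ret xi) + g (Ret xi)) <=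
      Lt / 2 * (rnorm xi ^+ 2 - rnorm (xi - eta) ^+ 2)].
Proof.
move=> Ox Oy [eta [stat desc yE]]; exists eta; rewrite yE.
have Oe : Omega (Ret eta) by rewrite -yE.
have R0 : Ret (0 : tangent x) = x by exact: retr0 hRet x.
have sm := retraction_smooth_le Ox Oe.
have de :
    metric x (grad f x) eta + Lt / 2 * rnorm eta ^+ 2 + g (Ret eta) <= g x.
  apply: (le_trans desc).
  rewrite /rpg_model (Defs.metric_sym (grad f x)) rnormE !metric0l.
  rewrite (congr1 g R0).
  by rewrite mulr0 !add0r.
split=> [//||xi Oxi].
  by move: sm de; set d := rnorm eta ^+ 2; set m := metric x _ _; lra.
have cx := retraction_convex_grad hRet hf hf_convex Ox Oxi.
have sg := retraction_convex_subgrad hRet hOmega hg hg_convex Ox Oe Oxi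
  (clarke_subdiff_quad stat).
(* When [sm], [cx] and [sg] are added, the terms in [grad f x] cancel. Raising [L] to [Lt] then
   completes the square. *)
have Ld : L * rnorm eta ^+ 2 <= Lt * rnorm eta ^+ 2.
  by rewrite ler_wpM2r ?sqr_ge0// ltW.
move: sm de sg Ld.
rewrite !rnormE !(metricBl, metricBr, metricNl, metricDl, metricZl)
  (Defs.metric_sym xi eta).
set m1 := metric x (grad f x) eta; move: cx; set m2 := metric x (grad f x) xi.
set e := metric x eta eta; set c := metric x eta xi.
lra.
Qed.

End OneStep.

(** * Telescoping over the iterations *)

Theorem theorem3p2 (R : realType) (n : nat) (M : riemannianManifold R n)
  (Ret : forall x : M, tangent x -> M) (hRet : retraction Ret)
  (F f g : M -> R) (hF : forall x, F x = f x + g x)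
  (hf : mdifferentiable f) (hg : continuous g)
  (x0 : M) (L Lt : R) (hLt : L < Lt)
  (hFbound : has_lbound (range F))
  (hcompact : compact [set x : M | F x <= F x0])
  (Omega : set M) (hOmega : open Omega)
  (hsub : [set x : M | F x <= F x0] `<=` Omega)
  (hf_smooth : retraction_smooth Ret L f Omega)
  (hf_convex : retraction_convex Ret f Omega)
  (hg_convex : retraction_convex Ret g Omega)
  (hinv : forall x y : M, Omega x -> Omega y ->
     exists! eta : tangent x, Ret x eta = y)
  (kappa : R)
  (hkappa : forall x y z : M, Omega x -> Omega y -> Omega z ->
     let eta_x := retr_inv Ret x y in
     let xi_x := retr_inv Ret x z in
     let zeta_y := retr_inv Ret y z in
     `| rnorm (xi_x - eta_x) ^+ 2 - rnorm zeta_y ^+ 2 |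
       <= kappa * rnorm eta_x ^+ 2)
  (x : nat -> M) (hx : rpg_sequence Ret f g Lt x0 x)
  (hxOmega : forall k, Omega (x k))
  (xs : M) (hxs : cluster (x @ \oo) xs) :
  let beta := (Lt - L) / 2 in
  forall k : nat, (1 <= k)%N ->
  F (x k) - F xs <=
    k%:R^-1 * (Lt / 2 * rnorm (retr_inv Ret x0 xs) ^+ 2
               + Lt * kappa / (2 * beta) * (F x0 - F xs)).
Proof.
move=> beta k k1.
have beta0 : 0 < beta by rewrite divr_gt0// subr_gt0.
set C := Lt * kappa / (2 * beta).
have [x0E step] := hx.
have retr_invE (y : M) (eta : tangent y) : Omega y -> Omega (Ret y eta) ->
    retr_inv Ret y (Ret y eta) = eta.
  move=> Oy Oe; have [e [_ eu]] := hinv _ _ Oy Oe.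
  by apply: xget_unique => // z /eu <-; exact: eu.
(* One nonzero vector with endpoint in [Omega] gives [L >= 0], hence [Lt > 0]; taking the second and
   third points of [hkappa] equal gives [kappa >= 0]. *)
have LtC (y : M) (eta : tangent y) :
    Omega y -> Omega (Ret y eta) -> eta != 0 -> 0 <= C.
  move=> Oy Oe eta0.
  have d0 : 0 < rnorm eta ^+ 2 by rewrite rnormE metric_pos.
  have Ld := retraction_smooth_convex_ge0 hRet hf hf_smooth hf_convex Oy Oe.
  have kd := le_trans (normr_ge0 _) (hkappa _ _ _ Oy Oe Oe).
  rewrite /= retr_invE// in kd.
  rewrite pmulr_lge0// in Ld; rewrite pmulr_lge0// in kd.
  rewrite divr_ge0// ?mulr_ge0//; lra.
have [eta etaP] : {eta : forall j, tangent (x j) |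
    forall j, [/\ Ret (x j) (eta j) = x j.+1,
      beta * rnorm (eta j) ^+ 2 <= F (x j) - F (x j.+1) &
      forall xi : tangent (x j), Omega (Ret (x j) xi) ->
        F (x j.+1) - F (Ret (x j) xi) <=
        Lt / 2 * (rnorm xi ^+ 2 - rnorm (xi - eta j) ^+ 2)]}.
  have h j := rpg_one_step hRet hf hg hLt hOmega hf_smooth hf_convex hg_convex
    (hxOmega j) (hxOmega j.+1) (step j).
  exists (fun j => projT1 (cid (h j))) => j.
  case: (cid (h j)) => e [eE ed ec] /=.
  by split => // [|xi /ec]; rewrite !hF.
have Fdecr j : F (x j.+1) <= F (x j).
  have [_ ed _] := etaP j; rewrite -subr_ge0; apply: le_trans ed.
  by rewrite mulr_ge0 ?sqr_ge0// ltW.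
have Fmono i j : (i <= j)%N -> F (x j) <= F (x i).
  elim: j => [|j IH]; first by rewrite leqn0 => /eqP ->.
  by rewrite leq_eqVlt => /predU1P[-> //|/IH]; apply: le_trans.
have Fcont : continuous F.
  rewrite (_ : F = f \+ g); last by apply/funext => y; exact: hF.
  by move=> y; apply: cvgD; [exact: mdifferentiable_continuous|exact: hg].
have Flim j : F xs <= F (x j).
  apply: (@cluster_closed _ _ [set y | F y <= F (x j)] _ hxs).
    by exists j => // i /= ij; exact: Fmono.
  by apply: (closed_comp (f := F)) (@closed_le _ _) => y _; exact: Fcont.
have Oxs : Omega xs by apply: hsub => /=; rewrite -x0E.
have retr_inv_xs j : Ret (x j) (retr_inv Ret (x j) xs) = xs.
  have [e [eE _]] := hinv _ _ (hxOmega j) Oxs.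
  by apply: (@xgetI _ 0 [set e : tangent (x j) | Ret (x j) e = xs] e).
pose a j := rnorm (retr_inv Ret (x j) xs) ^+ 2.
have a_ge0 j : 0 <= Lt * a j.
  have Oe : Omega (Ret (x j) (retr_inv Ret (x j) xs)) by rewrite retr_inv_xs.
  have := retraction_smooth_convex_ge0 hRet hf hf_smooth hf_convex
    (hxOmega j) Oe.
  by move/le_trans; apply; rewrite ler_wpM2r ?sqr_ge0// ltW.
(* [C] is chosen so that [C * beta = Lt * kappa / 2]. For a zero step the sign of [C] is unknown,
   but both sides vanish. *)
have key j :
    Lt / 2 * (kappa * rnorm (eta j) ^+ 2) <= C * (F (x j) - F (x j.+1)).
  have [eE ed _] := etaP j.
  have [e0|e0] := eqVneq (eta j) 0.
    have -> : x j.+1 = x j by rewrite -eE e0; exact: retr0 hRet _.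
    by rewrite e0 rnormE metric0l subrr !mulr0.
  have Oe : Omega (Ret (x j) (eta j)) by rewrite eE.
  have C0 := LtC _ _ (hxOmega j) Oe e0.
  apply: le_trans (ler_wpM2l C0 ed).
  rewrite le_eqVlt; apply/orP; left; apply/eqP.
  by rewrite /C; field; exact: lt0r_neq0.
have one j : F (x j.+1) - F xs <=
    Lt / 2 * (a j - a j.+1) + C * (F (x j) - F (x j.+1)).
  have [eE _ ec] := etaP j.
  have Oe : Omega (Ret (x j) (retr_inv Ret (x j) xs)) by rewrite retr_inv_xs.
  have := ec _ Oe; rewrite retr_inv_xs => h1.
  have ej : retr_inv Ret (x j) (x j.+1) = eta j.
    by rewrite -eE; apply: retr_invE; rewrite ?eE.
  have := hkappa _ _ _ (hxOmega j) (hxOmega j.+1) Oxs.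
  rewrite /= ej ler_norml => /andP[h2 _].
  have kj := key j.
  (* If [Lt < 0] then [L < 0], so every tangent vector in play is 0 and both sides vanish. *)
  have h3 : Lt * (a j.+1 - kappa * rnorm (eta j) ^+ 2) <=
            Lt * rnorm (retr_inv Ret (x j) xs - eta j) ^+ 2.
    have [Lt0|Lt0] := leP 0 Lt.
      rewrite ler_wpM2l// /a; move: h2.
      by set u := rnorm _ ^+ 2; set v := rnorm _ ^+ 2; lra.
    have vanish (i : nat) (v : tangent (x i)) : Omega (Ret (x i) v) -> v = 0.
      move=> Ov; apply/eqP/negPn/negP => v0.
      have := retraction_smooth_convex_ge0 hRet hf hf_smooth hf_convex
        (hxOmega i) Ov.
      rewrite rnormE pmulr_lge0; [lra|exact: metric_pos].
    have Oj : Omega (Ret (x j) (eta j)) by rewrite eE.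
    have Oe1 : Omega (Ret (x j.+1) (retr_inv Ret (x j.+1) xs)).
      by rewrite retr_inv_xs.
    rewrite /a (vanish _ _ Oe) (vanish _ _ Oj) (vanish _ _ Oe1) subrr.
    by rewrite !rnormE !metric0l !mulr0 subrr mulr0.
  move: h1 h3 kj; rewrite -/(a j); set u := rnorm _ ^+ 2; set v := rnorm _ ^+ 2.
  lra.
have sum j : j%:R * (F (x j) - F xs) <=
    Lt / 2 * (a 0%N - a j) + C * (F x0 - F (x j)).
  elim: j => [|j IH]; first by rewrite mul0r x0E !subrr !mulr0 addr0.
  (* Monotonicity lets the newest gap replace the [j] earlier ones, which is where the factor [1/k]
     comes from. *)
  have h : j%:R * (F (x j.+1) - F xs) <= j%:R * (F (x j) - F xs).
    by rewrite ler_wpM2l// lerB.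
  have -> : j.+1%:R = j%:R + 1 :> R by rewrite natr1.
  by have := one j; rewrite mulrDl mul1r; lra.
have CF : C * (F x0 - F (x k)) <= C * (F x0 - F xs).
  have [C0|C0] := leP 0 C; first by rewrite ler_wpM2l// lerB.
  (* A negative [C] excludes nonzero steps, so [F] is constant along the iterates and [F xs] cannot
     be smaller; the right side is then a product of two nonpositive factors. *)
  have Fconst j : F (x j) = F x0.
    elim: j => [|j <-]; first by rewrite x0E.
    have [eE _ _] := etaP j.
    have [e0|e0] := eqVneq (eta j) 0.
      by congr F; rewrite -eE e0; exact: retr0 hRet _.
    have Oe : Omega (Ret (x j) (eta j)) by rewrite eE.
    by have := LtC _ _ (hxOmega j) Oe e0; rewrite leNgt C0.
  have F0 : F x0 <= F xs.
    apply: (@cluster_closed _ _ [set y | F x0 <= F y] _ hxs).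
      by exists 0%N => // i _ /=; rewrite Fconst.
    by apply: (closed_comp (f := F)) (@closed_ge _ _) => y _; exact: Fcont.
  by rewrite Fconst subrr mulr0 mulr_le0 ?subr_le0 // ltW.
have k0 : 0 < (k%:R : R) by rewrite ltr0n.
rewrite ler_pdivlMl//; apply: (le_trans (sum k)).
have aE : a 0%N = rnorm (retr_inv Ret x0 xs) ^+ 2 by rewrite /a x0E.
(* The leftover [- Lt / 2 * a k] of the telescoped sum is nonpositive and is dropped. *)
have := a_ge0 k; rewrite -aE; lra.
Qed.
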